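(* Let $d\ge 1$, $k\ge 1$ and $n_1,\dots,n_d\ge 1$ be integers. There exists a u-cycle for $d$-dimensional $n_1\times n_2\times\cdots\times n_d$ matrices over the alphabet $\{1,2,\ldots,k\}$.
   Context: A u-cycle (universal cycle) for a set $S$ of $\ell$ words of length $n$ over an alphabet $A$ is a circular word $u_0u_1\cdots u_{\ell-1}$ over $A$ that contains each word of $S$ exactly once (and no other word) as a factor $u_iu_{i+1}\cdots u_{i+n-1}$ with $0\le i\le \ell-1$, indices taken modulo $\ell$. A $d$-dimensional $n_1\times\cdots\times n_d$ matrix over $\{1,\dots,k\}$ is a function $\{1,\dots,n_1\}\times\cdots\times\{1,\dots,n_d\}\to\{1,\dots,k\}$. Such a matrix is regarded as a word of length $n_d$ whose letters are its successive $(d-1)$-dimensional $n_1\times\cdots\times n_{d-1}$ slices along the last coordinate; that is, as a word of length $n_d$ over the alphabet $A$ of all $k^{n_1n_2\cdots n_{d-1}}$ matrices of size $n_1\times\cdots\times n_{d-1}$ over $\{1,\dots,k\}$ (for $d=1$, $A=\{1,\dots,k\}$). A u-cycle for these matrices is a u-cycle for the resulting set $S=A^{n_d}$ of words, of size $\ell=k^{n_1n_2\cdots n_d}$. *)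

(* Defs.v *)
From mathcomp Require Import all_boot.

Set Implicit Arguments.
Unset Strict Implicit.
Unset Printing Implicit Defensive.

Definition cyc_shift l (i : 'I_l) (j : nat) : 'I_l :=
  Ordinal (ltn_pmod (i + j) (leq_ltn_trans (leq0n i) (ltn_ord i))).

(* The length [l] may be smaller than [m]; the factor then wraps around the
   circular word several times. *)
Definition factor (A : Type) l (u : l.-tuple A) (m : nat) (i : 'I_l) :
    m.-tuple A :=
  [tuple tnth u (cyc_shift i j) | j < m].

Definition is_ucycle (A : finType) m (S : {set m.-tuple A})
    (u : #|S|.-tuple A) : Prop :=
  (forall w, w \in S -> exists! i : 'I_#|S|, factor u m i = w) /\
  (forall i : 'I_#|S|, factor u m i \in S).

Arguments is_ucycle {A m} S u.

Definition mindex d (n : 'I_d -> nat) : finType :=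
  {dffun forall i : 'I_d, 'I_(n i)}.

(* Entries and coordinates are numbered from 0: 'I_k stands for {1, ..., k}. *)
Definition ndmatrix (k d : nat) (n : 'I_d -> nat) : finType :=
  {ffun mindex n -> 'I_k}.

(* [lift ord_max i] has the same value as [i], so this drops the last size. *)
Definition init_dims d (n : 'I_d.+1 -> nat) : 'I_d -> nat :=
  fun i => n (lift ord_max i).

(* The multi-index (x_1, ..., x_d, j); [cast_ord] preserves values. *)
Definition mindex_rcons d (n : 'I_d.+1 -> nat)
    (x : mindex (init_dims n)) (j : 'I_(n ord_max)) : mindex n :=
  [ffun i : 'I_d.+1 =>
     match unliftP ord_max i with
     | UnliftSome i' e => cast_ord (congr1 n (esym e)) (x i')
     | UnliftNone e => cast_ord (congr1 n (esym e)) j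
     end : 'I_(n i)].

Definition slice k d (n : 'I_d.+1 -> nat) (M : ndmatrix k n)
    (j : 'I_(n ord_max)) : ndmatrix k (init_dims n) :=
  [ffun x => M (mindex_rcons x j)].

(* A matrix of dimension d.+1 read as a word of slices. For d = 0 the letters
   are 0-dimensional matrices, i.e. functions from a one-element type to
   'I_k. *)
Definition matrix_word k d (n : 'I_d.+1 -> nat) (M : ndmatrix k n) :
    (n ord_max).-tuple (ndmatrix k (init_dims n)) :=
  [tuple slice M j | j < n ord_max].

Definition matrix_words k d (n : 'I_d.+1 -> nat) :
    {set (n ord_max).-tuple (ndmatrix k (init_dims n))} :=
  [set matrix_word M | M : ndmatrix k n].

(* Main.v *)
Require Import Defs.
From mathcomp Require Import all_boot all_fingroup.

(** Reading a matrix as a word of slices is onto ([matrix_words_setT]): the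
    slices may be prescribed freely.  The claim is therefore that de Bruijn
    cycles exist over an arbitrary finite nonempty alphabet, here the alphabet
    of matrices of one dimension less.

    De Bruijn cycles are obtained by joining cycles.  Call a permutation [s] of
    the words of length [m.+1] a shift register if [s w] always consists of
    [w] without its first letter, followed by one new letter.  Rotating words
    by one letter is such a permutation.  Two words that differ only in their
    first letter may exchange their images under [s], and this merges their
    cycles if these are distinct.  So in a shift register with the fewest
    cycles, such words always share a cycle ([minimal_shift_register]).  Then
    every word reaches, inside its own cycle, all the words obtained by
    shifting in an arbitrary letter, hence after [m.+1] shifts every word
    ([fully_cyclic]): there is only one cycle.  The first letters met along
    that cycle spell a universal cycle, since the word at time [i] is formed by
    the first letters of the words at times [i], ..., [i + m]
    ([tnth_shift_register]). *)

Set Implicit Arguments.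
Unset Strict Implicit.
Unset Printing Implicit Defensive.

Local Open Scope group_scope.

Section DeBruijn.

Variables (A : finType) (m : nat).
Implicit Types (w y z : m.+1.-tuple A) (s : {perm m.+1.-tuple A}).

Definition shift_register s : bool :=
  [forall w : m.+1.-tuple A, behead w == take m (s w)].

Lemma shift_registerP s :
  reflect (forall w, behead w = take m (s w)) (shift_register s).
Proof. exact: 'forall_eqP. Qed.

Lemma rot1_tuple_inj : injective (fun w => [tuple of rot 1 w]).
Proof. by move=> w y /(congr1 val) /= /rot_inj /val_inj. Qed.

Lemma shift_register_rot : shift_register (perm rot1_tuple_inj).
Proof.
apply/shift_registerP => w; rewrite permE; case/tupleP: w => a v /=.
by rewrite rot1_cons -cats1 take_size_cat ?size_tuple.
Qed.

(** Composing with the transposition of two words that differ only in their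
    first letter gives again a shift register, and alters the number of cycles
    by exactly one; minimality forbids that it joins two of them. *)
Lemma minimal_shift_register :
  exists2 s, shift_register s &
    forall w y, behead w = behead y -> w \in porbit s y.
Proof.
have [s /shift_registerP sP smin] :=
  arg_minnP (fun s => #|porbits s|) shift_register_rot.
exists s => [|w y e]; first exact/shift_registerP.
apply/negPn/negP => wy.
have/smin : shift_register (tperm w y * s).
  by apply/shift_registerP => z; rewrite permM -sP; case: tpermP => // ->.
have := porbits_mul_tperm s w y; rewrite /= wy.
have -> /= : w != y by apply: contraNneq wy => ->; exact: porbit_id.
by rewrite addn2 addn1 => -[<-]; rewrite ltnn.
Qed.

Lemma shift_in_porbit s w y :
    shift_register s ->
    (forall w1 w2, behead w1 = behead w2 -> w1 \in porbit s w2) ->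
  behead w = take m y -> y \in porbit s w.
Proof.
move=> /shift_registerP sP sjoin e.
(* The predecessor of [y] agrees with [w] except perhaps in its first letter. *)
have : s^-1 y \in porbit s w by apply: sjoin; rewrite sP permKV.
rewrite -eq_porbit_mem => /eqP <-.
by have := mem_porbit s 1 (s^-1 y); rewrite expg1 permKV.
Qed.

(** Shifting in the letters of [y] one after the other turns [w] into [y]. *)
Lemma fully_cyclic s w :
    shift_register s ->
    (forall w1 w2, behead w1 = behead w2 -> w1 \in porbit s w2) ->
  porbit s w = [set: m.+1.-tuple A].
Proof.
move=> sS sjoin; apply/setP => y; rewrite inE.
have step j : j <= m.+1 ->
  exists2 z, z \in porbit s w & val z = drop j w ++ take j y.
  elim: j => [|j IH] lt_jm.
    by exists w; rewrite ?porbit_id // drop0 take0 cats0.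
  have [z zw ez] := IH (ltnW lt_jm).
  have sz : size (drop j.+1 w ++ take j.+1 y) == m.+1.
    by rewrite size_cat size_drop size_takel !size_tuple ?subnK.
  exists (Tuple sz) => //.
  rewrite -eq_porbit_mem in zw; rewrite -(eqP zw).
  apply: shift_in_porbit => //=; rewrite ez.
  have x0 : A := thead w.
  rewrite (drop_nth x0) ?size_tuple //= (take_nth x0) ?size_tuple //.
  rewrite -rcons_cat -cats1 take_size_cat //.
  by rewrite size_cat size_drop size_takel !size_tuple 1?ltnW // subSS subnK.
have [z zw ez] := step _ (leqnn _).
suff <- : z = y by [].
by apply: val_inj; rewrite ez drop_oversize ?take_oversize ?size_tuple.
Qed.

Lemma tnth_shift_register s w (j : 'I_m.+1) :
  shift_register s -> tnth w j = thead ((s ^+ j) w).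
Proof.
move=> /shift_registerP sP; case: j => j /=; elim: j w => [|j IH] w lt_jm.
  by rewrite expg0 perm1; congr tnth; apply: val_inj.
rewrite expgS permM -(IH (s w) (ltnW lt_jm)).
have x0 : A := thead w.
by rewrite !(tnth_nth x0) /= -nth_behead sP nth_take.
Qed.

Lemma ucycle_setT (a : A) :
  exists u : #|[set: m.+1.-tuple A]|.-tuple A, is_ucycle [set: _] u.
Proof.
have [s sS sjoin] := minimal_shift_register.
pose w0 : m.+1.-tuple A := nseq_tuple _ a.
have orb := fully_cyclic w0 sS sjoin.
set N := #|_|.
have N_orb : #|porbit s w0| = N by rewrite orb.
exists [tuple thead ((s ^+ i) w0) | i < N].
set u := mktuple _.
have factorE (i : 'I_N) : factor u m.+1 i = (s ^+ i) w0.
  apply: eq_from_tnth => j; rewrite !tnth_mktuple /= (tnth_shift_register _ j sS).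
  rewrite -permM -expgD; congr thead.
  (* Positions wrap around modulo [N], which is the period of [w0]. *)
  have per q : (s ^+ (q * N)%N) w0 = w0.
    elim: q => [|q IH]; first by rewrite perm1.
    by rewrite mulSn addnC expgD permM IH permX -N_orb iter_porbit.
  by rewrite [in RHS](divn_eq (i + j) N) expgD permM per.
split=> [w _|i]; last by rewrite inE.
have : w \in porbit s w0 by rewrite orb inE.
rewrite porbit_traject N_orb => /trajectP [i lt_iN ew].
exists (Ordinal lt_iN); split=> [|i' ei'].
  by rewrite factorE permX ew.
apply: val_inj; apply/eqP.
have := uniq_traject_porbit s w0; rewrite N_orb => uniqT.
rewrite -(nth_uniq w0 _ _ uniqT) ?size_traject ?ltn_ord //=.
by rewrite !nth_traject ?ltn_ord //= -ew -ei' factorE permX.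
Qed.

End DeBruijn.

Lemma mindex_rcons_max d (n : 'I_d.+1 -> nat) (x : mindex (init_dims n)) j :
  mindex_rcons x j ord_max = j.
Proof.
rewrite ffunE; case: unliftP => [i' e|e]; last exact: val_inj.
by case/eqP: (neq_lift ord_max i').
Qed.

Lemma mindex_rcons_lift d (n : 'I_d.+1 -> nat) (x : mindex (init_dims n)) j i :
  mindex_rcons x j (lift ord_max i) = x i.
Proof.
rewrite ffunE; case: unliftP => [i' e|e].
  by have ei := lift_inj e; subst i'; exact: val_inj.
by case/eqP: (neq_lift ord_max i).
Qed.

Lemma matrix_words_setT k d (n : 'I_d.+1 -> nat) :
  matrix_words k n = [set: (n ord_max).-tuple (ndmatrix k (init_dims n))].
Proof.
apply/setP => w; rewrite inE; apply/imsetP.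
pose init (x : mindex n) : mindex (init_dims n) :=
  [ffun i => x (lift ord_max i)].
exists [ffun x : mindex n => tnth w (x ord_max) (init x)] => //.
apply: eq_from_tnth => j; rewrite tnth_mktuple; apply/ffunP => x.
rewrite [RHS]ffunE [RHS]ffunE mindex_rcons_max; congr (tnth w j _).
by apply/ffunP => i; rewrite ffunE mindex_rcons_lift.
Qed.

Theorem theorem1p2 (d k : nat) (n : 'I_d.+1 -> nat)
    (hk : 0 < k) (hn : forall i : 'I_d.+1, 0 < n i) :
  exists u : #|matrix_words k n|.-tuple (ndmatrix k (init_dims n)),
    is_ucycle (matrix_words k n) u.
Proof.
rewrite matrix_words_setT.
have a : ndmatrix k (init_dims n) := [ffun=> Ordinal hk].
by case: (n ord_max) (hn ord_max) => // m _; exact: ucycle_setT.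
Qed.
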